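(* Let $\Gamma$ be a finite group and let $\gamma,\alpha\in R(\Gamma)$. Then, as operators on $\mathcal R_\Gamma=\bigoplus_{n\ge0}R(\Gamma_n)$, $$[\mathfrak O_{\hbar}(\gamma),\mathfrak p_{-1}(\alpha)]=\exp(\hbar\cdot\mathrm{ad}\,\mathfrak b)\,(\mathfrak p_{-1}(\gamma\alpha)),$$ $$[\mathfrak O^k(\gamma),\mathfrak p_{-1}(\alpha)]=\mathfrak p_{-1}^{(k)}(\gamma\alpha),\qquad k\ge 0,$$ where $\gamma\alpha$ is the convolution product.
   Context: A function $f$ on a finite group $G$ is identified with $\sum_{x\in G}f(x)x\in\mathbb C[G]$; $R(G)$ is the space of complex class functions, i.e. the center of $\mathbb C[G]$, with convolution product $\circ$ (the product of $\mathbb C[G]$). The wreath product is $\Gamma_n=\Gamma^n\rtimes S_n$ with $(g,\sigma)(h,\tau)=(g\,\sigma(h),\sigma\tau)$, $\sigma(h)=(h_{\sigma^{-1}(1)},\ldots,h_{\sigma^{-1}(n)})$; $\Gamma_0$ is trivial. For $\gamma\in\mathbb C[\Gamma]$, $\gamma^{(i)}\in\mathbb C[\Gamma_n]$ is its copy in the group algebra of the $i$-th factor of $\Gamma^n$. Jucys-Murphy elements: for $1\le j\le n$, $\xi_j=\xi_{j;n}=\sum_{i<j}\sum_a a\in\mathbb C[\Gamma_n]$, where $a$ runs over the elements $((g_1,\ldots,g_n),(i,j))$ with $g_k=1$ for $k\neq i,j$ and $g_j=g_i^{-1}$, $g_i\in\Gamma$ arbitrary ($\xi_1=0$; $\xi_j^0=1$).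 For $\alpha\in R(\Gamma)$, $k\ge0$: $\Xi_n^k(\alpha)=\sum_{i=1}^n\xi_i^k\circ\alpha^{(i)}$, which lies in $R(\Gamma_n)$. $\mathfrak O^k(\alpha)\in\mathrm{End}(\mathcal R_\Gamma)$ acts on each $R(\Gamma_n)$ as convolution with $\Xi_n^k(\alpha)$, and $\mathfrak O_\hbar(\alpha)=\sum_{k\ge0}\frac{\hbar^k}{k!}\mathfrak O^k(\alpha)$, with $\hbar$ a formal parameter. $\mathfrak b=\mathfrak O^1(1)$, where $1\in R(\Gamma)$ is the identity of the class algebra (characteristic function of the identity element). For $\mathfrak f\in\mathrm{End}(\mathcal R_\Gamma)$: $\mathfrak f^{(0)}=\mathfrak f$, $\mathfrak f^{(k)}=[\mathfrak b,\mathfrak f^{(k-1)}]$; $\mathfrak p_{-1}^{(k)}(\beta)$ means $(\mathfrak p_{-1}(\beta))^{(k)}$. $\mathfrak p_{-1}(\alpha):R(\Gamma_{n-1})\to R(\Gamma_n)$ is $y\mapsto\mathrm{Ind}_{\Gamma_{n-1}\times\Gamma}^{\Gamma_n}(y\otimes\alpha)=\frac1{(n-1)!}\sum_{g\in S_n}g(y\otimes\alpha)g^{-1}$, where $y\otimes\alpha\in\mathbb C[\Gamma_{n-1}\times\Gamma]\subset\mathbb C[\Gamma_n]$. *)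

(* Defs.v *)
From HB Require Import structures.
From mathcomp Require Import all_boot all_order all_algebra all_fingroup.
From mathcomp Require Import boolp functions reals complex.

Set Implicit Arguments.
Unset Strict Implicit.
Unset Printing Implicit Defensive.

Import GRing.Theory GroupScope.
Local Open Scope ring_scope.

Section GroupAlgebra.
Variables (F : fieldType) (gT : finGroupType).

(* The group algebra F[gT]: the function f stands for \sum_x f x * x, and the
   ring product _ * _ declared below is the convolution product. *)
Definition grpalg : Type := {ffun gT -> F}.
HB.instance Definition _ := GRing.Zmodule.on grpalg.

Implicit Types (f g h : grpalg) (x y z : gT) (a b : F).

Definition gdelta x : grpalg := [ffun y => (y == x)%:R].
Definition gconv f g : grpalg :=
  [ffun x => \sum_y f y * g (y^-1 * x)%g].
Definition gscale a f : grpalg := [ffun x => a * f x].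

Lemma grpalgP f g : (forall x, f x = g x) <-> f = g.
Proof. by split=> [eq_fg | -> //]; apply/ffunP=> x; apply: eq_fg. Qed.

Lemma gdeltaE x y : gdelta x y = (y == x)%:R.
Proof. by rewrite ffunE. Qed.

Lemma gaddE f g x : (f + g) x = f x + g x.
Proof. by rewrite ffunE. Qed.

Lemma gconvE f g x : gconv f g x = \sum_y f y * g (y^-1 * x)%g.
Proof. by rewrite ffunE. Qed.

Lemma gscaleE0 a f x : gscale a f x = a * f x.
Proof. by rewrite ffunE. Qed.

Lemma gconvA : associative gconv.
Proof.
move=> f g h; apply/grpalgP=> x; rewrite !gconvE.
under eq_bigr do rewrite gconvE big_distrr /=.
under [RHS]eq_bigr do rewrite gconvE big_distrl /=.
rewrite [RHS]exchange_big /=; apply: eq_bigr => y _.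
rewrite (reindex_inj (mulgI y^-1)%g) /=; apply: eq_bigr => z _.
by rewrite mulrA invMg invgK -mulgA mulKVg.
Qed.

Lemma gconv1f : left_id (gdelta 1%g) gconv.
Proof.
move=> f; apply/grpalgP=> x; rewrite gconvE (bigD1 1%g) //=.
rewrite gdeltaE eqxx mul1r invg1 mul1g big1 ?addr0 // => y /negPf yN1.
by rewrite gdeltaE yN1 mul0r.
Qed.

Lemma gconvf1 : right_id (gdelta 1%g) gconv.
Proof.
move=> f; apply/grpalgP=> x; rewrite gconvE (bigD1 x) //=.
rewrite mulVg gdeltaE eqxx mulr1 big1 ?addr0 // => y yNx.
by rewrite gdeltaE -eq_mulVg1 (negPf yNx) mulr0.
Qed.

Lemma gconvDl : left_distributive gconv +%R.
Proof.
move=> f g h; apply/grpalgP=> x; rewrite gaddE !gconvE -big_split /=.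
by apply: eq_bigr => y _; rewrite gaddE mulrDl.
Qed.

Lemma gconvDr : right_distributive gconv +%R.
Proof.
move=> f g h; apply/grpalgP=> x; rewrite gaddE !gconvE -big_split /=.
by apply: eq_bigr => y _; rewrite gaddE mulrDr.
Qed.

Lemma gdelta1_neq0 : gdelta 1%g != 0.
Proof.
apply/eqP=> /grpalgP/(_ 1%g)/eqP.
by rewrite gdeltaE eqxx ffunE oner_eq0.
Qed.

HB.instance Definition _ := GRing.Zmodule_isNzRing.Build grpalg
  gconvA gconv1f gconvf1 gconvDl gconvDr gdelta1_neq0.

Lemma gscaleA a b f : gscale a (gscale b f) = gscale (a * b) f.
Proof. by apply/grpalgP=> x; rewrite !gscaleE0 mulrA. Qed.

Lemma gscale1 : left_id 1 gscale.
Proof. by move=> f; apply/grpalgP=> x; rewrite gscaleE0 mul1r. Qed.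

Lemma gscaleDr : right_distributive gscale +%R.
Proof. by move=> a f g; apply/grpalgP=> x; rewrite !(gscaleE0, gaddE) mulrDr. Qed.

Lemma gscaleDl f : {morph gscale^~ f : a b / a + b}.
Proof. by move=> a b; apply/grpalgP=> x; rewrite !(gscaleE0, gaddE) mulrDl. Qed.

HB.instance Definition _ := GRing.Zmodule_isLmodule.Build F grpalg
  gscaleA gscale1 gscaleDr gscaleDl.

Lemma gmulE f g x : (f * g) x = \sum_y f y * g (y^-1 * x)%g.
Proof. exact: gconvE. Qed.

Lemma gscaleE a f x : (a *: f) x = a * f x.
Proof. exact: gscaleE0. Qed.

Lemma gsumE (I : Type) (r : seq I) (P : pred I) (G : I -> grpalg) x :
  (\sum_(i <- r | P i) G i) x = \sum_(i <- r | P i) G i x.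
Proof.
elim/big_rec2: _ => [|i a f _ <-]; last by rewrite gaddE.
by rewrite ffunE.
Qed.

Lemma gscalerAl a f g : a *: (f * g) = a *: f * g.
Proof.
apply/grpalgP=> x; rewrite gscaleE !gmulE big_distrr /=.
by apply: eq_bigr => y _; rewrite gscaleE mulrA.
Qed.

HB.instance Definition _ := GRing.Lmodule_isLalgebra.Build F grpalg gscalerAl.

Lemma gscalerAr a f g : a *: (f * g) = f * (a *: g).
Proof.
apply/grpalgP=> x; rewrite gscaleE !gmulE big_distrr /=.
by apply: eq_bigr => y _; rewrite gscaleE mulrCA.
Qed.

HB.instance Definition _ := GRing.Lalgebra_isAlgebra.Build F grpalg gscalerAr.

Lemma gdelta1 : gdelta 1%g = 1.
Proof. by []. Qed.

Lemma gdeltaMl x f y : (gdelta x * f) y = f (x^-1 * y)%g.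
Proof.
rewrite gmulE (bigD1 x) //= gdeltaE eqxx mul1r big1 ?addr0 // => z /negPf zNx.
by rewrite gdeltaE zNx mul0r.
Qed.

Lemma gdeltaMr x f y : (f * gdelta x) y = f (y * x^-1)%g.
Proof.
rewrite gmulE (bigD1 (y * x^-1)%g) //= invMg invgK mulgKV gdeltaE eqxx mulr1.
rewrite big1 ?addr0 // => z zNx; rewrite gdeltaE.
case: eqP => [zyx|]; last by rewrite mulr0.
by case/eqP: zNx; rewrite -zyx invMg invgK mulgA mulgV mul1g.
Qed.

Lemma gdeltaM x y : gdelta x * gdelta y = gdelta (x * y)%g.
Proof.
apply/grpalgP=> z; rewrite gdeltaMl !gdeltaE.
by rewrite -(inj_eq (mulgI x)) mulKVg.
Qed.

Lemma gdelta_sum f : f = \sum_x f x *: gdelta x.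
Proof.
apply/grpalgP=> y; rewrite gsumE (bigD1 y) //= gscaleE gdeltaE eqxx mulr1.
rewrite big1 ?addr0 // => x xNy.
by rewrite gscaleE gdeltaE eq_sym (negPf xNy) mulr0.
Qed.

Definition class_fun : {pred grpalg} :=
  fun f => [forall x, forall y, f (x ^ y)%g == f x].

Lemma class_funP f :
  reflect (forall x y, f (x ^ y)%g = f x) (f \in class_fun).
Proof.
apply: (iffP forallP) => [cf x y | cf x]; last by apply/forallP=> y; rewrite cf.
by have /forallP/(_ y)/eqP := cf x.
Qed.

Lemma class_fun_comm f :
  (f \in class_fun) <-> (forall x, gdelta x * f = f * gdelta x).
Proof.
split=> [/class_funP cf x | cf].
  apply/grpalgP=> y; rewrite gdeltaMl gdeltaMr -[in RHS](cf _ x) conjgE.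
  by rewrite mulgKV.
apply/class_funP=> x y; have /grpalgP/(_ (x * y)%g) := cf y.
by rewrite gdeltaMl gdeltaMr mulgK conjgE.
Qed.

Lemma class_fun_subalg : GRing.subsemialg_closed class_fun.
Proof.
split.
- by apply/class_fun_comm=> x; rewrite mulr1 mul1r.
- split=> [|f g /class_fun_comm cf /class_fun_comm cg].
    by apply/class_fun_comm=> x; rewrite mulr0 mul0r.
  by apply/class_fun_comm=> x; rewrite mulrDl mulrDr cf cg.
- move=> a f /class_fun_comm cf; apply/class_fun_comm=> x.
  by rewrite -scalerAr cf scalerAl.
move=> f g /class_fun_comm cf /class_fun_comm cg; apply/class_fun_comm=> x.
by rewrite mulrA cf -mulrA cg mulrA.
Qed.

End GroupAlgebra.

Section ClassFunctions.
Variables (F : fieldType) (gT : finGroupType).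

(* R(gT), as a subalgebra of F[gT]; class_fun_comm above identifies it with the
   center. *)
Record classalg : Type := ClassAlg {
  class_val :> grpalg F gT;
  class_valP : class_val \in @class_fun F gT }.

HB.instance Definition _ := [isSub for class_val].
HB.instance Definition _ := [Choice of classalg by <:].
HB.instance Definition _ :=
  GRing.SubChoice_isSubAlgebra.Build F (grpalg F gT) (@class_fun F gT) classalg
    (@class_fun_subalg F gT).

End ClassFunctions.

Section Wreath.
Variables (gT : finGroupType) (n : nat).

Record wreath : Type := Wreath {
  wbase : {ffun 'I_n -> gT};
  wperm : {perm 'I_n} }.

Definition wreath_pair (x : wreath) := (wbase x, wperm x).
Definition pair_wreath p := Wreath p.1 p.2.
Lemma wreath_pairK : cancel wreath_pair pair_wreath.
Proof. by case. Qed.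

HB.instance Definition _ := Finite.copy wreath (can_type wreath_pairK).

(* s(h) = (h_{s^-1(1)}, ..., h_{s^-1(n)}) *)
Definition wact (s : {perm 'I_n}) (h : {ffun 'I_n -> gT}) : {ffun 'I_n -> gT} :=
  [ffun i => h ((s^-1)%g i)].

(* (g, s) (h, t) = (g s(h), s o t). In MathComp, the composite s o t of
   permutations is written t * s. *)
Definition wmul (x y : wreath) : wreath :=
  Wreath [ffun i => wbase x i * wact (wperm x) (wbase y) i]%g
         (wperm y * wperm x)%g.

Definition wone : wreath := Wreath [ffun=> 1%g] 1%g.
Definition winv (x : wreath) : wreath :=
  Wreath [ffun i => ((wbase x (wperm x i))^-1)%g] (wperm x)^-1%g.

Lemma wmulA : associative wmul.
Proof.
move=> [g s] [h t] [k u]; rewrite /wmul /=; congr Wreath; last by rewrite mulgA.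
by apply/ffunP=> i; rewrite !ffunE /= invMg permM mulgA.
Qed.

Lemma wmul1 : left_id wone wmul.
Proof.
move=> [g s]; rewrite /wmul /= mulg1; congr Wreath.
by apply/ffunP=> i; rewrite !ffunE /= invg1 perm1 mul1g.
Qed.

Lemma wmulV : left_inverse wone winv wmul.
Proof.
move=> [g s]; rewrite /wmul /= mulgV; congr Wreath.
by apply/ffunP=> i; rewrite !ffunE /= invgK mulVg.
Qed.

HB.instance Definition _ := Finite_isGroup.Build wreath wmulA wmul1 wmulV.

Lemma wmulE g s h t :
  (Wreath g s * Wreath h t)%g = Wreath [ffun i => g i * h (s^-1 i)]%g (t * s)%g.
Proof.
rewrite /mul /= /wmul /=; congr Wreath.
by apply/ffunP=> i; rewrite !ffunE.
Qed.

(* (1, s) *)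
Definition wperm_elt (s : {perm 'I_n}) : wreath := Wreath [ffun=> 1%g] s.

(* The element a of the i-th factor of the base group. *)
Definition wat (i : 'I_n) (a : gT) : wreath :=
  Wreath [ffun k => if k == i then a else 1%g] 1%g.

(* ((g_k)_k, (i j)) with g_i = a, g_j = a^-1 and g_k = 1 otherwise. *)
Definition wtransp (i j : 'I_n) (a : gT) : wreath :=
  Wreath [ffun k => if k == i then a else if k == j then (a^-1)%g else 1%g]
         (tperm i j).

End Wreath.

Section RingAux.
Variable A : nzRingType.
Implicit Types x y T Q : A.

Lemma swap_exprs T Q x y k :
    T * x = y * T - Q -> T * y = x * T + Q ->
    GRing.comm x y -> GRing.comm Q x -> GRing.comm Q y ->
  exists h, [/\ T * x ^+ k = y ^+ k * T - h * Q,
                T * y ^+ k = x ^+ k * T + h * Q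
              & h * (x - y) = x ^+ k - y ^+ k].
Proof.
move=> Tx Ty xy Qx Qy; elim: k => [|k [h [Txk Tyk hxy]]].
  by exists 0; rewrite !expr0 !mul0r subr0 addr0 subrr mulr1 mul1r.
have hE : y ^+ k + h * x = x ^+ k + h * y.
  by apply/eqP; rewrite -subr_eq -addrA -mulrBr hxy addrC subrK.
exists (y ^+ k + h * x); split.
- rewrite exprSr mulrA Txk mulrBl -mulrA Tx mulrBr mulrA -exprSr.
  by rewrite -[h * Q * x]mulrA Qx mulrA mulrDl opprD addrA.
- rewrite exprSr mulrA Tyk mulrDl -mulrA Ty mulrDr mulrA -exprSr.
  by rewrite -[h * Q * y]mulrA Qy mulrA hE mulrDl addrA.
rewrite mulrDl -mulrA (_ : x * (x - y) = (x - y) * x); last first.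
  by rewrite mulrBl mulrBr xy.
rewrite mulrA hxy mulrBl mulrBr -!exprSr addrC addrA subrK.
by rewrite addrC addrC.
Qed.

Lemma commr_mull x y z : GRing.comm x z -> GRing.comm y z ->
  GRing.comm (x * y) z.
Proof. by move=> xz yz; apply/commr_sym/commrM; apply: commr_sym. Qed.

Lemma swap_sum T Q h x y u v :
    T * x = y * T - h * Q -> T * y = x * T + h * Q ->
    T * u = v * T -> T * v = u * T -> Q * u = Q * v ->
  GRing.comm T (x * u + y * v).
Proof.
move=> Tx Ty Tu Tv Quv; rewrite /GRing.comm mulrDr mulrDl !mulrA Tx Ty.
rewrite mulrBl mulrDl -!mulrA Tu Tv Quv.
by rewrite addrACA addNr addr0 addrC.
Qed.

End RingAux.

Section WreathFacts.
Variables (gT : finGroupType) (n : nat).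
Implicit Types (i j k : 'I_n) (s t : {perm 'I_n}) (h : {ffun 'I_n -> gT})
  (a : gT).
Local Notation W := (wreath gT n).
Local Notation pe := (@wperm_elt gT n).

Lemma wreath_split (x : W) : x = (Wreath (wbase x) 1 * pe (wperm x))%g.
Proof.
case: x => g s; rewrite wmulE mulg1 /=; congr Wreath.
by apply/ffunP=> i; rewrite !ffunE mulg1.
Qed.

Lemma wperm_eltM s t : (pe s * pe t = pe (t * s))%g.
Proof.
by rewrite wmulE; congr Wreath; apply/ffunP=> i; rewrite !ffunE mulg1.
Qed.

Lemma wperm_elt1 : pe 1 = 1%g.
Proof. by []. Qed.

Lemma wperm_eltV s : ((pe s)^-1 = pe s^-1)%g.
Proof.
by apply/eqP; rewrite eq_invg_mul wperm_eltM mulVg wperm_elt1.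
Qed.

Lemma wperm_base s h :
  (pe s * Wreath h 1 = Wreath (wact s h) 1 * pe s)%g.
Proof.
rewrite !wmulE mul1g mulg1; congr Wreath.
by apply/ffunP=> i; rewrite !ffunE mul1g mulg1.
Qed.

Lemma base_wperm s h :
  (Wreath h 1 * pe s = pe s * Wreath [ffun i => h (s i)] 1)%g.
Proof.
rewrite wperm_base; congr (Wreath _ _ * _)%g.
by apply/ffunP=> i; rewrite !ffunE permKV.
Qed.

Lemma wperm_wat s i a : (pe s * wat i a = wat (s i) a * pe s)%g.
Proof.
rewrite wperm_base; congr (Wreath _ _ * _)%g; apply/ffunP=> k.
by rewrite !ffunE (canF_eq (permKV s)).
Qed.

Lemma wperm_wtransp s i j a :
  (pe s * wtransp i j a = wtransp (s i) (s j) a * pe s)%g.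
Proof.
rewrite !wmulE -tpermJ conjgE mulKVg; congr Wreath.
apply/ffunP=> k.
by rewrite !ffunE mul1g mulg1 !(canF_eq (permKV s)).
Qed.

Lemma wtranspC i j a : i != j -> wtransp i j a = wtransp j i a^-1%g.
Proof.
move=> iNj; rewrite /wtransp tpermC; congr Wreath; apply/ffunP=> k.
rewrite !ffunE invgK; have [->|] := eqVneq k j; first by rewrite eq_sym (negPf iNj).
by [].
Qed.

Lemma base_wtransp i j a h : i != j ->
  (Wreath h 1 * wtransp i j a
     = wtransp i j (h i * a * (h j)^-1) * Wreath h 1)%g.
Proof.
move=> iNj; rewrite !wmulE mulg1 mul1g; congr Wreath; apply/ffunP=> k.
rewrite !ffunE invg1 perm1 tpermV.
have [->|kNi] := eqVneq k i; first by rewrite tpermL mulgKV.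
have [->|kNj] := eqVneq k j; last by rewrite mulg1 mul1g tpermD // eq_sym.
by rewrite tpermR !invMg invgK mulgA mulgKV.
Qed.

Lemma wtransp_split i j a :
  (wtransp i j a = Wreath (wbase (wtransp i j a)) 1 * pe (tperm i j))%g.
Proof. exact: wreath_split. Qed.

Lemma base_wat i a h :
  (Wreath h 1 * wat i a = wat i (h i * a * (h i)^-1) * Wreath h 1)%g.
Proof.
rewrite !wmulE mulg1; congr Wreath; apply/ffunP=> k.
rewrite !ffunE invg1 perm1; have [->|] := eqVneq k i; first by rewrite mulgKV.
by rewrite mulg1 mul1g.
Qed.

End WreathFacts.

Section JucysMurphy.
Variables (F : fieldType) (gT : finGroupType) (n : nat).
Local Notation W := (wreath gT n).
Local Notation A := (grpalg F W).
Local Notation D := (@gdelta F W).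
Local Notation pe := (@wperm_elt gT n).
Implicit Types (i j k : 'I_n) (s t : {perm 'I_n}) (h : {ffun 'I_n -> gT})
  (a : gT).

Definition jucys_murphy (j : 'I_n) : A :=
  \sum_(i < n | (i < j)%N) \sum_(a : gT) D (wtransp i j a).

(* c^(i) *)
Definition galg_copy (c : grpalg F gT) (i : 'I_n) : A :=
  \sum_(a : gT) c a *: D (wat i a).

Definition Xi_val (k : nat) (c : grpalg F gT) : A :=
  \sum_(i < n) jucys_murphy i ^+ k * galg_copy c i.

Let P i j : A := \sum_(a : gT) D (wtransp i j a).
Let T s : A := D (pe s).
Let B h : A := D (Wreath h 1%g).

Let PC i j : i != j -> P i j = P j i.
Proof.
move=> iNj; rewrite /P (reindex_inj invg_inj) /=; apply: eq_bigr => a _.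
by rewrite wtranspC // invgK.
Qed.

Let TP s i j : T s * P i j = P (s i) (s j) * T s.
Proof.
rewrite /P mulr_sumr mulr_suml; apply: eq_bigr => a _.
by rewrite !gdeltaM wperm_wtransp.
Qed.

Let BP h i j : i != j -> GRing.comm (B h) (P i j).
Proof.
move=> iNj; rewrite /GRing.comm /P mulr_sumr mulr_suml.
rewrite [RHS](reindex (fun a => h i * a * (h j)^-1)%g) /=; last first.
  exists (fun a => (h i)^-1 * a * h j)%g => a _.
    by rewrite !mulgA mulVg mul1g mulgKV.
  by rewrite !mulgA mulgV mul1g mulgK.
by apply: eq_bigr => a _; rewrite !gdeltaM base_wtransp.
Qed.

Let jmE j : jucys_murphy j = \sum_(i < n | (i < j)%N) P i j.
Proof. by []. Qed.

Let Bjm h j : GRing.comm (B h) (jucys_murphy j).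
Proof.
apply: commr_sum => i lt_ij; apply: BP.
by apply: contraTneq lt_ij => ->; rewrite ltnn.
Qed.

Let Tjm s j : s j = j -> (forall i, (s i < j)%N = (i < j)%N) ->
  GRing.comm (T s) (jucys_murphy j).
Proof.
move=> sj sltj; rewrite /GRing.comm jmE mulr_sumr mulr_suml.
rewrite [RHS](reindex_inj (@perm_inj _ s)) /=.
by apply: eq_big => [i | i _]; rewrite ?sltj // TP sj.
Qed.

Let jmC_lt i j : (i < j)%N -> GRing.comm (jucys_murphy j) (jucys_murphy i).
Proof.
move=> ltij; apply: commr_sum => k ltki; apply: commr_sum => a _.
rewrite wtransp_split -gdeltaM; apply: commrM; apply: commr_sym.
  exact: Bjm.
apply: Tjm => [|l]; last first.
  by case: tpermP => [->|->|//]; rewrite ltij (ltn_trans ltki ltij).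
by rewrite tpermD // -val_eqE /= ltn_eqF // (ltn_trans ltki ltij).
Qed.

Let jmC i j : GRing.comm (jucys_murphy j) (jucys_murphy i).
Proof.
case: (ltngtP i j) => [/jmC_lt // | /jmC_lt /commr_sym // | /val_inj -> //].
Qed.

Let Tcopy s c i : T s * galg_copy c i = galg_copy c (s i) * T s.
Proof.
rewrite mulr_sumr mulr_suml; apply: eq_bigr => a _.
by rewrite -scalerAr -scalerAl !gdeltaM wperm_wat.
Qed.

Let Bcopy h c i : c \in @class_fun F gT -> GRing.comm (B h) (galg_copy c i).
Proof.
move=> /class_funP cf; rewrite /GRing.comm mulr_sumr mulr_suml.
rewrite [RHS](reindex (fun a => h i * a * (h i)^-1)%g) /=; last first.
  exists (fun a => (h i)^-1 * a * h i)%g => a _.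
    by rewrite !mulgA mulVg mul1g mulgKV.
  by rewrite !mulgA mulgV mul1g mulgK.
apply: eq_bigr => a _; rewrite -scalerAr -scalerAl !gdeltaM base_wat.
by rewrite -[in RHS](cf _ (h i)) conjgE !mulgA mulgKV mulVg mul1g.
Qed.

Section Adjacent.
Variables (a b : 'I_n) (ab : b = a.+1 :> nat).
Let s := tperm a b.

Let aNb : a != b.
Proof. by rewrite -val_eqE /= ab ltn_eqF. Qed.

Let Q := P a b * T s.

Let sltE l i : l != a -> l != b -> (s i < l)%N = (i < l)%N.
Proof.
rewrite -!val_eqE /= => la lb; rewrite /s; case: tpermP => [->|->|//].
  by rewrite ab [RHS]leq_eqVlt -ab eq_sym (negPf lb).
by rewrite ab [LHS]leq_eqVlt -ab eq_sym (negPf lb).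
Qed.

Let Tjm_b : jucys_murphy b = P a b + \sum_(i < n | (i < a)%N) P i b.
Proof.
rewrite jmE (bigD1 a) /= ?ab //; congr (_ + _); apply: eq_bigl => i.
by rewrite -val_eqE /= ltnS ltn_neqAle andbC.
Qed.

Let Tjm_a : T s * jucys_murphy a = jucys_murphy b * T s - Q.
Proof.
rewrite Tjm_b mulrDl addrC addKr jmE mulr_sumr mulr_suml.
apply: eq_bigr => i ltia; rewrite TP /s tpermL tpermD //.
  by rewrite -val_eqE /= gtn_eqF.
by rewrite -val_eqE /= gtn_eqF // ab ltnS ltnW.
Qed.

Let TP_ab : T s * P a b = Q.
Proof. by rewrite TP /s tpermL tpermR PC // eq_sym. Qed.

Let Ts2 : T s * T s = 1.
Proof. by rewrite /T gdeltaM wperm_eltM tperm2 wperm_elt1. Qed.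

Let Tjm_b' : T s * jucys_murphy b = jucys_murphy a * T s + Q.
Proof.
have := congr1 (fun z => T s * z * T s) Tjm_a.
rewrite mulrA Ts2 mul1r mulrBr mulrBl mulrA -[_ * _ * _ * T s]mulrA Ts2 mulr1.
by move=> ->; rewrite -TP_ab !mulrA Ts2 mul1r TP_ab subrK.
Qed.

Let QE : Q = \sum_(c : gT) B (wbase (wtransp a b c)).
Proof.
rewrite /Q /P mulr_suml; apply: eq_bigr => c _.
by rewrite {1}wtransp_split -!gdeltaM -mulrA -/(T s) Ts2 mulr1.
Qed.

Let Qjm j : GRing.comm Q (jucys_murphy j).
Proof.
by apply: commr_sym; rewrite QE; apply: commr_sum => c _; apply/commr_sym/Bjm.
Qed.

Let Qcopy c : c \in @class_fun F gT -> Q * galg_copy c a = Q * galg_copy c b.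
Proof.
move=> cc.
have -> : Q * galg_copy c b = galg_copy c b * Q.
  rewrite QE mulr_suml mulr_sumr; apply: eq_bigr => x _.
  exact: Bcopy.
rewrite {1}/Q -mulrA Tcopy /s tpermL mulrA -/s.
have PT : GRing.comm (P a b) (galg_copy c b).
  apply: commr_sum => x _; rewrite /GRing.comm -scalerAr -scalerAl.
  by congr (_ *: _); apply/esym/BP.
by rewrite PT mulrA.
Qed.

Lemma Xi_adjacent (k : nat) c : c \in @class_fun F gT -> GRing.comm (T s) (Xi_val k c).
Proof.
move=> cc.
have [h [Ta Tb _]] :=
  swap_exprs k Tjm_a Tjm_b' (jmC b a) (Qjm a) (Qjm b).
rewrite /GRing.comm /Xi_val (bigD1 a) // (bigD1 b) 1?eq_sym //= !addrA.
rewrite mulrDr mulrDl; congr (_ + _); last first.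
  rewrite mulr_sumr mulr_suml; apply: eq_bigr => l /andP[la lb].
  have sl : s l = l by rewrite /s tpermD // eq_sym.
  rewrite mulrA commrX; last by apply: Tjm => // i; apply: sltE.
  by rewrite -!mulrA Tcopy sl.
apply: (swap_sum Ta Tb); last exact: Qcopy.
  by rewrite Tcopy /s tpermL.
by rewrite Tcopy /s tpermR.
Qed.

End Adjacent.

Lemma Xi_tperm (k : nat) c i j : c \in @class_fun F gT ->
  GRing.comm (T (tperm i j)) (Xi_val k c).
Proof.
move=> cc; wlog lt_ij : i j / (i < j)%N => [wl|].
  have [/wl //|/wl ji|/val_inj ->] := ltngtP i j; first by rewrite tpermC.
  by rewrite tperm1; apply/commr_sym/commr1.
have [m mE] : exists m, j = (i + m).+1 :> nat.
  by exists (j - i.+1)%N; rewrite -addSn subnKC.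
elim: m j mE {lt_ij} => [|m IHm] j jE.
  by apply: Xi_adjacent => //; rewrite jE addn0.
have lt_j' : ((i + m).+1 < n)%N.
  by apply: leq_ltn_trans (ltn_ord j); rewrite jE addnS.
pose j' := Ordinal lt_j'.
have iNj' : i != j' by rewrite -val_eqE /= ltn_eqF // ltnS leq_addr.
have iNj : i != j by rewrite -val_eqE /= jE ltn_eqF // ltnS leq_addr.
have -> : tperm i j = (tperm i j' ^ tperm j' j)%g.
  by rewrite tpermJ tpermL tpermD // eq_sym.
have Tj'j : GRing.comm (T (tperm j' j)) (Xi_val k c).
  by apply: Xi_adjacent => //; rewrite jE addnS.
rewrite conjgE tpermV /T -!wperm_eltM -!gdeltaM.
by do 2?apply: commr_mull => //; apply: IHm.
Qed.

Lemma Xi_class (k : nat) c : c \in @class_fun F gT -> Xi_val k c \in @class_fun F W.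
Proof.
move=> cc; apply/class_fun_comm=> x; rewrite (wreath_split x) -gdeltaM.
apply: commr_mull.
  apply: commr_sum => i _; apply: commrM; last exact: Bcopy.
  by apply: commrX; apply: Bjm.
case: (prod_tpermP (wperm x)) => ts -> _.
elim: ts => [|t ts IH]; first by rewrite big_nil; apply/commr_sym/commr1.
rewrite big_cons -wperm_eltM -gdeltaM; apply: commr_mull; first exact: IH.
exact: Xi_tperm.
Qed.

End JucysMurphy.

Section Induction.
Variables (F : fieldType) (gT : finGroupType) (n : nat).
Local Notation D := (@gdelta F (wreath gT n.+1)).

(* The embedding of wreath gT n x gT in wreath gT n.+1, where gT is the last
   factor of the base group and the permutations fix the last index. *)
Definition wjoin (x : wreath gT n) (a : gT) : wreath gT n.+1 :=
  Wreath [ffun k => oapp (wbase x) a (unlift ord_max k)]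
         (lift_perm ord_max ord_max (wperm x)).

(* y (x) c in F[wreath gT n x gT], embedded in F[wreath gT n.+1]. *)
Definition outer (y : grpalg F (wreath gT n)) (c : grpalg F gT) :
    grpalg F (wreath gT n.+1) :=
  \sum_(x : wreath gT n) \sum_(a : gT) (y x * c a) *: D (wjoin x a).

(* Induction from wreath gT n x gT to wreath gT n.+1 of y (x) c. *)
Definition ind_val (y : grpalg F (wreath gT n)) (c : grpalg F gT) :
    grpalg F (wreath gT n.+1) :=
  (n`!%:R)^-1 *: \sum_(s : {perm 'I_n.+1})
    D (wperm_elt gT s) * outer y c * D (wperm_elt gT s)^-1%g.

Lemma wjoinM x y a b : (wjoin x a * wjoin y b = wjoin (x * y) (a * b))%g.
Proof.
case: x y => [g s] [h t]; rewrite /wjoin !wmulE /= lift_permM; congr Wreath.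
apply/ffunP=> k; rewrite !ffunE lift_permV.
case: (unliftP ord_max k) => [j|] -> /=.
  by rewrite lift_perm_lift !liftK /= ffunE.
by rewrite lift_perm_id !unlift_none.
Qed.

Lemma wjoinV x a : ((wjoin x a)^-1 = wjoin x^-1 a^-1)%g.
Proof.
apply/eqP; rewrite eq_invg_mul wjoinM !mulgV /wjoin /= lift_perm1.
by apply/eqP; congr Wreath; apply/ffunP=> k; rewrite !ffunE; case: unlift => //= i; rewrite ffunE.
Qed.

Lemma outer_comm y c x a : y \in @class_fun F (wreath gT n) ->
  c \in @class_fun F gT -> GRing.comm (D (wjoin x a)) (outer y c).
Proof.
move=> /class_funP yc /class_funP cc; rewrite /GRing.comm mulr_sumr mulr_suml.
rewrite [RHS](reindex_inj (conjg_inj x^-1)%g) /=; apply: eq_bigr => z _.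
rewrite mulr_sumr mulr_suml.
rewrite [RHS](reindex_inj (conjg_inj a^-1)%g) /=; apply: eq_bigr => b _.
rewrite -scalerAr -scalerAl !gdeltaM !wjoinM yc cc.
by rewrite !conjgE !invgK !mulgA !mulgKV.
Qed.

Lemma ind_class y c : y \in @class_fun F (wreath gT n) ->
  c \in @class_fun F gT -> ind_val y c \in @class_fun F (wreath gT n.+1).
Proof.
move=> yc cc; apply/class_fun_comm=> x; rewrite /ind_val -scalerAr -scalerAl.
congr (_ *: _).
rewrite mulr_sumr mulr_suml (reindex_inj (mulIg (wperm x)^-1)%g) /=.
apply: eq_bigr => s _.
have [h xE] : exists h, (x * wperm_elt gT (s * (wperm x)^-1) =
    wperm_elt gT s * Wreath h 1)%g.
  exists [ffun i => wbase x (s i)].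
  rewrite {1}[x]wreath_split -mulgA wperm_eltM mulgKV base_wperm.
  by [].
have hE : Wreath h 1 = wjoin (Wreath [ffun i => h (lift ord_max i)] 1) (h ord_max).
  rewrite /wjoin /= lift_perm1; congr Wreath; apply/ffunP=> k; rewrite ffunE.
  by case: (unliftP ord_max k) => [j|] -> //=; rewrite ffunE.
have VxE : ((wperm_elt gT (s * (wperm x)^-1))^-1 =
    (Wreath h 1)^-1 * (wperm_elt gT s)^-1 * x)%g.
  by rewrite -invMg -xE invMg mulgKV.
rewrite !mulrA gdeltaM xE -gdeltaM VxE -!gdeltaM !mulrA.
congr (_ * _ * _); rewrite -!mulrA; congr (_ * _).
rewrite mulrA hE outer_comm // -mulrA gdeltaM mulgV gdelta1 mulr1.
by [].
Qed.

End Induction.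

Section DirectSum.
Variables (F : fieldType) (V : nat -> lmodType F).

(* The direct sum of the V n, i.e. the families of finite support. *)
Record dirsum : Type := DirSum {
  ds_val :> forall n, V n;
  ds_fin : exists N, forall n, (N <= n)%N -> ds_val n = 0 }.

HB.instance Definition _ := gen_eqMixin dirsum.
HB.instance Definition _ := gen_choiceMixin dirsum.

Implicit Types x y z : dirsum.

Lemma dirsumP x y : (forall n, x n = y n) -> x = y.
Proof.
case: x y => [x xf] [y yf] /= xy.
have {}xy : x = y by apply: functional_extensionality_dep.
by subst y; congr DirSum; apply: Prop_irrelevance.
Qed.

Lemma ds_fin_add x y : exists N, forall n, (N <= n)%N -> x n + y n = 0.
Proof.
case: (ds_fin x) (ds_fin y) => [N xN] [M yM].
by exists (maxn N M) => n; rewrite geq_max => /andP[/xN -> /yM ->]; rewrite addr0.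
Qed.

Lemma ds_fin_image (W : nat -> lmodType F) (f : forall n, V n -> W n) x :
  (forall n, f n 0 = 0) -> exists N, forall n, (N <= n)%N -> f n (x n) = 0.
Proof. by move=> f0; case: (ds_fin x) => N xN; exists N => n /xN ->. Qed.

Lemma ds_fin_zero : exists N, forall n, (N <= n)%N -> (0 : V n) = 0.
Proof. by exists 0%N. Qed.

Definition ds_zero := DirSum ds_fin_zero.
Definition ds_add x y := DirSum (ds_fin_add x y).
Definition ds_opp x := 
  DirSum (@ds_fin_image V (fun n v => - v) x (fun n => oppr0 (V n))).
Definition ds_scale (a : F) x :=
  DirSum (@ds_fin_image V (fun n v => a *: v) x (fun n => scaler0 (V n) a)).

Lemma ds_addA : associative ds_add.
Proof. by move=> x y z; apply: dirsumP => n; apply: addrA. Qed.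
Lemma ds_addC : commutative ds_add.
Proof. by move=> x y; apply: dirsumP => n; apply: addrC. Qed.
Lemma ds_add0 : left_id ds_zero ds_add.
Proof. by move=> x; apply: dirsumP => n; apply: add0r. Qed.
Lemma ds_addN : left_inverse ds_zero ds_opp ds_add.
Proof. by move=> x; apply: dirsumP => n; apply: addNr. Qed.

HB.instance Definition _ :=
  GRing.isZmodule.Build dirsum ds_addA ds_addC ds_add0 ds_addN.

Lemma ds_scaleA a b x : ds_scale a (ds_scale b x) = ds_scale (a * b) x.
Proof. by apply: dirsumP => n; apply: scalerA. Qed.
Lemma ds_scale1 : left_id 1 ds_scale.
Proof. by move=> x; apply: dirsumP => n; apply: scale1r. Qed.
Lemma ds_scaleDr : right_distributive ds_scale +%R.
Proof. by move=> a x y; apply: dirsumP => n; apply: scalerDr. Qed.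
Lemma ds_scaleDl x : {morph ds_scale^~ x : a b / a + b}.
Proof. by move=> a b; apply: dirsumP => n; apply: scalerDl. Qed.

HB.instance Definition _ := GRing.Zmodule_isLmodule.Build F dirsum
  ds_scaleA ds_scale1 ds_scaleDr ds_scaleDl.

End DirectSum.

Section Endomorphisms.
Variables (F : fieldType) (M : lmodType F).

(* The algebra of linear endomorphisms; f * g is the composite f o g. *)
Record endo : Type := Endo {
  endo_fun :> M -> M;
  endo_linear : linear endo_fun }.

HB.instance Definition _ (f : endo) :=
  GRing.isLinear.Build F M M *:%R (endo_fun f) (endo_linear f).
HB.instance Definition _ := gen_eqMixin endo.
HB.instance Definition _ := gen_choiceMixin endo.

Implicit Types f g h : endo.

Lemma endoP f g : (forall x, f x = g x) -> f = g.
Proof.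
case: f g => [f lf] [g lg] /= /funext fg.
by subst g; congr Endo; apply: Prop_irrelevance.
Qed.

Definition endo_of (f : {linear M -> M}) : endo := Endo (@linearP _ _ _ _ f).

Definition endo_zero := endo_of \0.
Definition endo_one := endo_of idfun.
Definition endo_add f g := endo_of (f \+ g).
Definition endo_opp f := endo_of (\- f).
Definition endo_scale (a : F) f := endo_of (a \*: f).
Definition endo_comp f g := endo_of (f \o g).

Lemma endo_addA : associative endo_add.
Proof. by move=> f g h; apply: endoP => x; apply: addrA. Qed.
Lemma endo_addC : commutative endo_add.
Proof. by move=> f g; apply: endoP => x; apply: addrC. Qed.
Lemma endo_add0 : left_id endo_zero endo_add.
Proof. by move=> f; apply: endoP => x; apply: add0r. Qed.
Lemma endo_addN : left_inverse endo_zero endo_opp endo_add.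
Proof. by move=> f; apply: endoP => x; apply: addNr. Qed.

HB.instance Definition _ :=
  GRing.isZmodule.Build endo endo_addA endo_addC endo_add0 endo_addN.

Lemma endo_compA : associative endo_comp.
Proof. by move=> f g h; apply: endoP. Qed.
Lemma endo_comp1f : left_id endo_one endo_comp.
Proof. by move=> f; apply: endoP. Qed.
Lemma endo_compf1 : right_id endo_one endo_comp.
Proof. by move=> f; apply: endoP. Qed.
Lemma endo_compDl : left_distributive endo_comp +%R.
Proof. by move=> f g h; apply: endoP. Qed.
Lemma endo_compDr : right_distributive endo_comp +%R.
Proof. by move=> f g h; apply: endoP => x; apply: raddfD. Qed.

HB.instance Definition _ := GRing.Zmodule_isPzRing.Build endo
  endo_compA endo_comp1f endo_compf1 endo_compDl endo_compDr.

Lemma endo_scaleA a b f : endo_scale a (endo_scale b f) = endo_scale (a * b) f.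
Proof. by apply: endoP => x; apply: scalerA. Qed.
Lemma endo_scale1 : left_id 1 endo_scale.
Proof. by move=> f; apply: endoP => x; apply: scale1r. Qed.
Lemma endo_scaleDr : right_distributive endo_scale +%R.
Proof. by move=> a f g; apply: endoP => x; apply: scalerDr. Qed.
Lemma endo_scaleDl f : {morph endo_scale^~ f : a b / a + b}.
Proof. by move=> a b; apply: endoP => x; apply: scalerDl. Qed.

HB.instance Definition _ := GRing.Zmodule_isLmodule.Build F endo
  endo_scaleA endo_scale1 endo_scaleDr endo_scaleDl.

Lemma endo_mulE f g x : (f * g) x = f (g x).
Proof. by []. Qed.

End Endomorphisms.

Section PowerSeries.

(* E[[hbar]]: A n is the coefficient of hbar^n, and the product is the Cauchy
   product. *)
Definition fps (E : Type) : Type := nat -> E.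

Section Ring.
Variable E : pzRingType.
Implicit Types A B C : fps E.

HB.instance Definition _ := GRing.Zmodule.on (fps E).

Definition fps_const (a : E) : fps E := fun n => if n is 0%N then a else 0.
Definition fps_mul A B : fps E := fun n => \sum_(i < n.+1) A i * B (n - i)%N.

Lemma fps_addE A B n : (A + B) n = A n + B n.
Proof. by []. Qed.

Lemma fps_mulA : associative fps_mul.
Proof.
move=> A B C; apply: funext => n; rewrite /fps_mul.
pose G i j := A i * (B (j - i)%N * C (n - j)%N).
transitivity (\sum_(i < n.+1) \sum_(j < n.+1 | (i <= j)%N) G i j).
  apply: eq_bigr => i _; rewrite mulr_sumr.
  rewrite -(big_mkord xpredT (fun j => A i * (B j * C (n - i - j)%N))).
  rewrite -(big_mkord (fun j => (i <= j)%N) (G i)).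
  rewrite [RHS](big_cat_nat _ (n := i)) ?leq0n ?(ltnW (ltn_ord i)) //=.
  rewrite [X in _ = X + _]big_nat_cond [X in _ = X + _]big_pred0 ?add0r;
    last first.
    by move=> j; case: ltnP => //; rewrite leqNgt => /negPf ->; rewrite andbF.
  rewrite -[X in index_iota X n.+1]add0n big_addn subSn ?leq_ord //.
  apply: eq_big => [j | j _]; first by rewrite leq_addl.
  by rewrite /G addnK subnDA subnAC.
rewrite (exchange_big_dep xpredT) //=; apply: eq_bigr => j _.
rewrite mulr_suml (big_ord_widen_cond n.+1 xpredT
  (fun i => A i * B (j - i)%N * C (n - j)%N)) //=.
by apply: eq_bigr => i _; rewrite /G mulrA.
Qed.

Lemma fps_mul1f : left_id (fps_const 1) fps_mul.
Proof.
move=> A; apply: funext => n; rewrite /fps_mul big_ord_recl /= mul1r subn0.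
by rewrite big1 ?addr0 // => i _; rewrite mul0r.
Qed.

Lemma fps_mulf1 : right_id (fps_const 1) fps_mul.
Proof.
move=> A; apply: funext => n; rewrite /fps_mul big_ord_recr /= subnn mulr1.
rewrite big1 ?add0r // => i _; rewrite -(subnSK (ltn_ord i)) /=.
by rewrite mulr0.
Qed.

Lemma fps_mulDl : left_distributive fps_mul +%R.
Proof.
move=> A B C; apply: funext => n.
rewrite fps_addE /fps_mul -big_split /=.
by apply: eq_bigr => i _; rewrite -mulrDl.
Qed.

Lemma fps_mulDr : right_distributive fps_mul +%R.
Proof.
move=> A B C; apply: funext => n.
rewrite fps_addE /fps_mul -big_split /=.
by apply: eq_bigr => i _; rewrite -mulrDr.
Qed.

HB.instance Definition _ := GRing.Zmodule_isPzRing.Build (fps E)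
  fps_mulA fps_mul1f fps_mulf1 fps_mulDl fps_mulDr.

Lemma fps_mulE A B n : (A * B) n = \sum_(i < n.+1) A i * B (n - i)%N.
Proof. by []. Qed.

End Ring.
End PowerSeries.

Definition lie (E : pzRingType) (f g : E) : E := f * g - g * f.

(* The operator exp(hbar D) = \sum_k hbar^k / k! D^k on E[[hbar]], for an
   operator D of E extended coefficientwise to E[[hbar]]. *)
Definition exp_hbar (F : fieldType) (E : lmodType F) (D : E -> E) (A : fps E) :
    fps E :=
  fun n => \sum_(k < n.+1) (k`!%:R)^-1 *: iter k D (A (n - k)%N).

Section Operators.
Variables (F : fieldType) (gT : finGroupType).

Definition wreath_classes (n : nat) : lmodType F :=
  classalg F (wreath gT n).
Definition wreath_sum : Type := dirsum wreath_classes.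
HB.instance Definition _ := GRing.Lmodule.on wreath_sum.

Definition Xi (n k : nat) (c : classalg F gT) : classalg F (wreath gT n) :=
  ClassAlg (Xi_class n k (class_valP c)).

Definition ind (n : nat) (y : classalg F (wreath gT n)) (c : classalg F gT) :
    classalg F (wreath gT n.+1) :=
  ClassAlg (ind_class (class_valP y) (class_valP c)).

Lemma outer_linear n c : linear (fun y => @outer F gT n y c).
Proof.
move=> a y z; rewrite /outer scaler_sumr -big_split /=; apply: eq_bigr => x _.
rewrite scaler_sumr -big_split /=; apply: eq_bigr => b _.
by rewrite gaddE gscaleE mulrDl scalerDl scalerA mulrA.
Qed.

Lemma ind_linear n c : linear (fun y => @ind n y c).
Proof.
move=> a y z; apply: val_inj => /=; rewrite /ind_val scalerA mulrC -scalerA.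
rewrite -scalerDr; congr (_ *: _).
rewrite scaler_sumr -big_split /=; apply: eq_bigr => s _.
by rewrite outer_linear mulrDr mulrDl -scalerAr -scalerAl.
Qed.

Lemma ind0 n c : @ind n 0 c = 0.
Proof.
by have := ind_linear c (-1) (0 : classalg F (wreath gT n)) 0;
  rewrite !scaleN1r !addNr.
Qed.

Definition O_fun (k : nat) (c : classalg F gT) (x : wreath_sum) : wreath_sum :=
  DirSum (@ds_fin_image F wreath_classes wreath_classes
            (fun n y => Xi n k c * y) x (fun n => mulr0 (Xi n k c))).

Lemma O_linear k c : linear (O_fun k c).
Proof.
by move=> a x y; apply: dirsumP => n /=; rewrite mulrDr -scalerAr.
Qed.

Definition O_op (k : nat) (c : classalg F gT) : endo wreath_sum :=
  Endo (O_linear k c).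

Definition O_hbar (c : classalg F gT) : fps (endo wreath_sum) :=
  fun k => (k`!%:R)^-1 *: O_op k c.

Definition b_op : endo wreath_sum := O_op 1 1.

(* p_{-1}(c): in degree 0 the result is 0, since p_{-1}(c) raises the degree
   by one. *)
Definition p_val (c : classalg F gT) (x : wreath_sum) (n : nat) :
    wreath_classes n :=
  if n is m.+1 then ind (x m) c else 0.

Lemma p_fin c (x : wreath_sum) :
  exists N, forall n, (N <= n)%N -> p_val c x n = 0.
Proof.
case: (ds_fin x) => N xN; exists N.+1 => -[//|n] /xN /= ->.
exact: ind0.
Qed.

Definition p_fun (c : classalg F gT) (x : wreath_sum) : wreath_sum :=
  DirSum (p_fin c x).

Lemma p_linear c : linear (p_fun c).
Proof.
move=> a x y; apply: dirsumP => -[|n] /=; last exact: ind_linear.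
by rewrite scaler0 addr0.
Qed.

Definition p_op (c : classalg F gT) : endo wreath_sum := Endo (p_linear c).

(* f^(k), with f^(0) = f and f^(k.+1) = [b, f^(k)] *)
Definition b_deriv (k : nat) (f : endo wreath_sum) : endo wreath_sum :=
  iter k (lie b_op) f.

End Operators.

(* Main.v *)
(* Write Xi_{n+1}^k(c) = Xi_n^k(c) (x) 1 + xi_{n+1}^k c^{(n+1)}. As the left-hand
   side is central, it can be moved under the sum defining the induction of
   y (x) alpha, so [O^k(gamma), p_{-1}(alpha)] y is the average over the s in
   S_{n+1} of s xi_{n+1}^k (y (x) gamma alpha) s^{-1}. The same argument with
   xi_{n+1}^k (y (x) c) in place of y (x) c and Xi^1(1) in place of Xi^k(gamma)
   shows that ad b raises the exponent of xi_{n+1} by one in such averages,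
   so that b_deriv k p_{-1}(gamma alpha) is given by the same formula. *)
Require Import Defs.
From HB Require Import structures.
From mathcomp Require Import all_boot all_order all_algebra all_fingroup.
From mathcomp Require Import boolp functions reals complex.

Set Implicit Arguments.
Unset Strict Implicit.
Unset Printing Implicit Defensive.

Import GRing.Theory.
Local Open Scope ring_scope.
Local Open Scope complex_scope.

(** * The outer product as a bilinear, multiplicative map *)

Section Outer.
Variables (F : fieldType) (gT : finGroupType) (n : nat).
Implicit Types (y z : grpalg F (wreath gT n)) (c d : grpalg F gT).
Local Notation top := (@ord_max n).

Lemma outerDl y z c : outer (y + z) c = outer y c + outer z c.
Proof. by have := outer_linear c 1 y z; rewrite !scale1r. Qed.

Lemma outer0l c : outer (0 : grpalg F (wreath gT n)) c = 0.
Proof.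
by have /eqP := outerDl 0 0 c; rewrite addr0 addrC -subr_eq subrr => /eqP.
Qed.

Lemma outer_suml (I : Type) (r : seq I) (P : pred I)
    (G : I -> grpalg F (wreath gT n)) c :
  outer (\sum_(i <- r | P i) G i) c = \sum_(i <- r | P i) outer (G i) c.
Proof. exact: (big_morph _ (fun y z => outerDl y z c) (outer0l c)). Qed.

Lemma outerZl a y c : outer (a *: y) c = a *: outer y c.
Proof. by have := outer_linear c a y 0; rewrite !addr0 outer0l addr0. Qed.

Lemma outerE y c :
  outer y c = \sum_x \sum_a (y x * c a) *: gdelta F (@wjoin gT n x a).
Proof. by []. Qed.

Lemma outer_delta x a :
  outer (gdelta F x) (gdelta F a) = gdelta F (@wjoin gT n x a).
Proof.
rewrite outerE (bigD1 x) //= [X in _ + X]big1 ?addr0 => [|z /negPf zNx].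
  rewrite (bigD1 a) //= [X in _ + X]big1 ?addr0 => [|b /negPf bNa].
    by rewrite !gdeltaE !eqxx mulr1 scale1r.
  by rewrite [gdelta F a b]gdeltaE bNa mulr0 scale0r.
by apply: big1 => b _; rewrite [gdelta F x z]gdeltaE zNx mul0r scale0r.
Qed.

Lemma outerDr y c d : outer y (c + d) = outer y c + outer y d.
Proof.
rewrite outerE -big_split /=; apply: eq_bigr => x _; rewrite -big_split /=.
by apply: eq_bigr => a _; rewrite gaddE mulrDr scalerDl.
Qed.

Lemma outerZr a y c : outer y (a *: c) = a *: outer y c.
Proof.
rewrite outerE scaler_sumr; apply: eq_bigr => x _; rewrite scaler_sumr.
by apply: eq_bigr => b _; rewrite gscaleE mulrCA scalerA.
Qed.

Lemma outer0r y : outer y 0 = 0.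
Proof. by have := outerZr 0 y 0; rewrite !scale0r. Qed.

Lemma outer_bigr (I : Type) (r : seq I) (P : pred I) y (G : I -> grpalg F gT) :
  outer y (\sum_(i <- r | P i) G i) = \sum_(i <- r | P i) outer y (G i).
Proof. exact: (big_morph _ (outerDr y) (outer0r y)). Qed.

(** By linearity in all four arguments it reduces to basis elements, where it says that [wjoin] is a
    group homomorphism ([wjoinM]). *)
Lemma outerM y z c d : outer (y * z) (c * d) = outer y c * outer z d.
Proof.
rewrite (gdelta_sum y) mulr_suml !outer_suml [RHS]mulr_suml.
apply: eq_bigr => x _; rewrite -scalerAl 2!outerZl -scalerAl; congr (_ *: _).
rewrite (gdelta_sum z) mulr_sumr !outer_suml mulr_sumr.
apply: eq_bigr => x' _; rewrite -scalerAr 2!outerZl -scalerAr; congr (_ *: _).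
rewrite gdeltaM (gdelta_sum c) [X in outer _ X]mulr_suml 2!outer_bigr.
rewrite [RHS]mulr_suml; apply: eq_bigr => a _.
rewrite -scalerAl 2!outerZr -scalerAl; congr (_ *: _).
rewrite (gdelta_sum d) [X in outer _ X]mulr_sumr 2!outer_bigr.
rewrite [RHS]mulr_sumr; apply: eq_bigr => b _.
rewrite -scalerAr 2!outerZr -scalerAr; congr (_ *: _).
by rewrite gdeltaM !outer_delta gdeltaM wjoinM.
Qed.

Lemma outer1 : outer (1 : grpalg F (wreath gT n)) (1 : grpalg F gT) = 1.
Proof.
rewrite -!gdelta1 outer_delta; congr gdelta; rewrite /wjoin /= lift_perm1.
congr Wreath; apply/ffunP=> k; rewrite !ffunE.
by case: unlift => //= i; rewrite ffunE.
Qed.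

Lemma outerX y k : outer (y ^+ k) 1 = outer y 1 ^+ k.
Proof.
by elim: k => [|k IH]; rewrite ?outer1 // !exprS -IH -outerM mulr1.
Qed.

(** * Copies and Jucys-Murphy elements under the embedding *)

Lemma wat_top (a : gT) : wat top a = wjoin 1%g a.
Proof.
rewrite /wat /wjoin /= lift_perm1; congr Wreath; apply/ffunP=> k; rewrite !ffunE.
case: (unliftP top k) => [j|] -> /=; last by rewrite eqxx.
by rewrite eq_sym (negPf (neq_lift _ _)) ffunE.
Qed.

Lemma wat_lift (i : 'I_n) (a : gT) : wat (lift top i) a = wjoin (wat i a) 1%g.
Proof.
rewrite /wat /wjoin /= lift_perm1; congr Wreath; apply/ffunP=> k; rewrite !ffunE.
case: (unliftP top k) => [j|] -> /=; last by rewrite (negPf (neq_lift _ _)).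
by rewrite (inj_eq lift_inj) ffunE.
Qed.

Lemma wtransp_lift (i j : 'I_n) (a : gT) :
  wtransp (lift top i) (lift top j) a = wjoin (wtransp i j a) 1%g.
Proof.
rewrite /wtransp /wjoin /=; congr Wreath.
  apply/ffunP=> k; rewrite !ffunE.
  case: (unliftP top k) => [l|] -> /=; last by rewrite !(negPf (neq_lift _ _)).
  by rewrite !(inj_eq lift_inj) ffunE.
apply/permP=> k; case: (unliftP top k) => [l|] ->.
  rewrite lift_perm_lift; case: tpermP => [/lift_inj->|/lift_inj->|].
  - by rewrite tpermL.
  - by rewrite tpermR.
  by move=> /eqP; rewrite (inj_eq lift_inj) => li /eqP;
    rewrite (inj_eq lift_inj) => lj; rewrite tpermD // eq_sym.
by rewrite lift_perm_id tpermD // eq_sym neq_lift.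
Qed.

Lemma galg_copy_top c : galg_copy c top = outer (1 : grpalg F (wreath gT n)) c.
Proof.
rewrite [in RHS](gdelta_sum c) outer_bigr; apply: eq_bigr => a _.
by rewrite outerZr -gdelta1 outer_delta wat_top.
Qed.

Lemma galg_copy_lift c (i : 'I_n) :
  galg_copy c (lift top i) = outer (galg_copy c i) 1.
Proof.
rewrite outer_suml; apply: eq_bigr => a _.
by rewrite outerZl -gdelta1 outer_delta wat_lift.
Qed.

(** [lift top i] has the same value as [i], so the defining sum still runs over indices below [i];
    [top] never occurs in it. *)
Lemma jucys_murphy_lift (i : 'I_n) :
  jucys_murphy F gT (lift top i) = outer (jucys_murphy F gT i) 1.
Proof.
have lift_i : bump n i = i := lift_max i.
rewrite /jucys_murphy big_mkcond big_ord_recr /= lift_i ltnNge ltnW //= addr0.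
rewrite outer_suml [RHS]big_mkcond /=; apply: eq_bigr => j _.
case: ifP => // _; rewrite outer_suml; apply: eq_bigr => a _.
rewrite -gdelta1 outer_delta -wtransp_lift; congr (gdelta _ (wtransp _ _ _)).
exact/val_inj/esym/lift_max.
Qed.

Lemma Xi_val_top k c :
  Xi_val n.+1 k c
    = outer (Xi_val n k c) 1 + jucys_murphy F gT top ^+ k * outer 1 c.
Proof.
rewrite /Xi_val big_ord_recr /= galg_copy_top; congr (_ + _).
rewrite outer_suml; apply: eq_bigr => i _.
have -> : widen_ord (leqnSn n) i = lift top i.
  exact/val_inj/esym/lift_max.
by rewrite jucys_murphy_lift galg_copy_lift -outerX -outerM mulr1.
Qed.

(* Induction of [xi_{n+1}^k (y (x) c)]; for [k = 0] it is [ind_val y c]. *)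
Definition ind_jm (k : nat) y c : grpalg F (wreath gT n.+1) :=
  (n`!%:R)^-1 *: \sum_(s : {perm 'I_n.+1})
    gdelta F (wperm_elt gT s) * (jucys_murphy F gT top ^+ k * outer y c)
      * gdelta F (wperm_elt gT s)^-1%g.

Lemma ind_jm0 y c : ind_jm 0 y c = ind_val y c.
Proof. by rewrite /ind_jm; under eq_bigr do rewrite expr0 mul1r. Qed.

(* The central element Xi_{n+1}^l(d) can be moved next to y (x) c, where all
   but the last of its summands cancel against the second term. *)
Lemma Xi_ind_jm l k d y c : d \in @class_fun F gT ->
  Xi_val n.+1 l d * ind_jm k y c - ind_jm k (Xi_val n l d * y) c
    = ind_jm (k + l) y (d * c).
Proof.
move=> dc; have /class_fun_comm Xc := Xi_class n.+1 l dc.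
(* Commutation with group elements extends linearly; below it is also applied to a power of
   [jucys_murphy F gT top]. *)
have {}Xc (u : grpalg F (wreath gT n.+1)) : GRing.comm (Xi_val n.+1 l d) u.
  rewrite (gdelta_sum u); apply: commr_sum => x _.
  by rewrite /GRing.comm -scalerAr -scalerAl Xc.
rewrite /ind_jm -scalerAr -scalerBr; congr (_ *: _).
rewrite mulr_sumr -sumrB; apply: eq_bigr => s _.
rewrite !mulrA Xc -!mulrA -mulrBr; congr (_ * _).
rewrite !mulrA -mulrBl; congr (_ * _); rewrite Xc -!mulrA -mulrBr exprD -mulrA.
(* With [c] read as [1 * c], the subtracted term is [outer (Xi_val n l d) 1 * outer y c], so
   [Xi_val_top] leaves only the top summand. *)
congr (_ * _); rewrite -[c in outer (_ * y) c]mul1r outerM -mulrBl.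
by rewrite Xi_val_top addrC addKr -mulrA -outerM mul1r.
Qed.

End Outer.

(** * Commutators on the direct sum, degree by degree *)

Section Commutators.
Variables (F : fieldType) (gT : finGroupType).
Implicit Types c d : classalg F gT.

Lemma endo_scalerAl (M : lmodType F) (a : F) (f g : endo M) :
  (a *: f) * g = a *: (f * g).
Proof. exact: endoP. Qed.

Lemma endo_scalerAr (M : lmodType F) (a : F) (f g : endo M) :
  f * (a *: g) = a *: (f * g).
Proof. by apply: endoP => x; apply: linearZ. Qed.

Lemma lie_endoE (M : lmodType F) (f g : endo M) x :
  lie f g x = f (g x) - g (f x).
Proof. by []. Qed.

Lemma lie_O_p0 k d c (x : wreath_sum F gT) :
  lie (O_op k d) (p_op c) x 0%N = 0.
Proof. by rewrite /= mulr0 subr0. Qed.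

Lemma lie_O_pS k d c (x : wreath_sum F gT) n :
  class_val (lie (O_op k d) (p_op c) x n.+1) = ind_jm k (x n) (d * c).
Proof. by rewrite /= -!ind_jm0 Xi_ind_jm ?class_valP. Qed.

Lemma b_deriv_p0 k c (x : wreath_sum F gT) : b_deriv k (p_op c) x 0%N = 0.
Proof.
elim: k x => [|k IH] x //; rewrite /b_deriv iterS lie_endoE /= -/(b_deriv k _).
by rewrite !IH mulr0 subr0.
Qed.

Lemma b_deriv_pS k c (x : wreath_sum F gT) n :
  class_val (b_deriv k (p_op c) x n.+1) = ind_jm k (x n) c.
Proof.
(* [x] stays general: the commutator with [b_op] uses the induction hypothesis at [x] and at [b_op]
   applied to [x]. *)
elim: k x => [|k IH] x; first by rewrite ind_jm0.
rewrite /b_deriv iterS lie_endoE /= -/(b_deriv k _).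
rewrite !IH /= Xi_ind_jm ?addn1 ?mul1r //.
exact: (class_valP (1 : classalg F gT)).
Qed.

Lemma lie_O_p k d c : lie (O_op k d) (p_op c) = b_deriv k (p_op (d * c)).
Proof.
apply: endoP => x; apply: dirsumP => -[|n]; first by rewrite lie_O_p0 b_deriv_p0.
by apply: val_inj; rewrite [LHS]lie_O_pS [RHS]b_deriv_pS.
Qed.

(** * Coefficients of power series in [hbar] *)

Lemma lie_fps_const (E : pzRingType) (A : fps E) (f : E) n :
  lie A (fps_const f) n = lie (A n) f.
Proof.
rewrite /lie; congr (_ - _).
  rewrite fps_mulE big_ord_recr /= subnn big1 ?add0r // => i _.
  (* For [i < n] the index [n - i] is a successor, where [fps_const f] vanishes. *)
  by rewrite -(subnSK (ltn_ord i)) mulr0.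
rewrite fps_mulE big_ord_recl /= subn0 big1 ?addr0 // => i _.
by rewrite mul0r.
Qed.

(** The terms with [k < n] iterate [D] on a zero coefficient, and [D 0 = 0] keeps them zero. *)
Lemma exp_hbar_const (M : lmodType F) (D : endo M -> endo M) (f : endo M) n :
  D 0 = 0 -> exp_hbar D (fps_const f) n = (n`!%:R)^-1 *: iter n D f.
Proof.
move=> D0; rewrite /exp_hbar big_ord_recr /= subnn big1 ?add0r // => i _.
by rewrite -(subnSK (ltn_ord i)) /= iter_fix // scaler0.
Qed.

End Commutators.

Theorem theorem3p15 (R : realType) (gT : finGroupType)
    (gamma alpha : classalg R[i] gT) :
  lie (O_hbar gamma) (fps_const (p_op alpha))
    = exp_hbar (lie (b_op R[i] gT)) (fps_const (p_op (gamma * alpha)))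
  /\ (forall k : nat,
        lie (O_op k gamma) (p_op alpha) = b_deriv k (p_op (gamma * alpha))).
Proof.
split=> [|k]; last exact: lie_O_p.
apply: funext => n; rewrite lie_fps_const exp_hbar_const.
  (* At [hbar ^ n] both sides carry the factor [1 / n!]; what remains is the second identity for
     [k = n]. *)
  by rewrite -[iter _ _ _]lie_O_p /lie endo_scalerAl endo_scalerAr scalerBr.
by rewrite /lie mulr0 mul0r subrr.
Qed.
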